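(* Every operator $V \in \mathrm{ri}(\mathcal{B}_m)$ is strictly regular.
   Context: $S^{m-1} = \{x = (x_1, \dots, x_m) \in \mathbb{R}^m : \sum_{i=1}^m x_i = 1,\ x_i \ge 0\}$ is the standard simplex. A quadratic stochastic operator (QSO) is a map $V : S^{m-1} \to S^{m-1}$ of the form $V(x)_k = \sum_{i,j=1}^m p_{ij,k} x_i x_j$ for $k = 1, \dots, m$, where $p_{ij,k} = p_{ji,k} \ge 0$ and $\sum_{r=1}^m p_{ij,r} = 1$ for all $i, j, k \in \{1, \dots, m\}$. A QSO is identified with its (unique) array of coefficients $(p_{ij,k})$, an element of the space $M_m^c(\mathbb{R})$ of real $m \times m \times m$ cubic matrices; convex combinations and topology on sets of QSOs are those of $M_m^c(\mathbb{R}) \cong \mathbb{R}^{m^3}$. For $x \in S^{m-1}$, let $x_{[1]} \ge \dots \ge x_{[m]}$ be its coordinates in non-increasing order; for $x, y \in S^{m-1}$ write $x \prec y$ if $\sum_{i=1}^k x_{[i]} \le \sum_{i=1}^k y_{[i]}$ for $k = 1, \dots, m-1$. A quadratic bistochastic operator (QBO) is a QSO $V$ with $V(x) \prec x$ for all $x \in S^{m-1}$. $\mathcal{B}_m$ denotes the set of all QBOs on $S^{m-1}$; it is a closed convex subset of $M_m^c(\mathbb{R})$. $\mathrm{ri}(\mathcal{B}_m)$ is the relative interior of $\mathcal{B}_m$, i.e. its interior as a subset of its affine hull in $M_m^c(\mathbb{R})$. A QSO $V$ is regular if for every $x \in S^{m-1}$ the trajectory $\{V^n(x)\}_{n \ge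 0}$ converges; a regular QSO is strictly regular if it has a unique fixed point. *)

(* Defs.v *)
From HB Require Import structures.
From mathcomp Require Import all_boot all_order all_algebra.
From mathcomp Require Import all_classical all_reals all_analysis.
Set Implicit Arguments.
Unset Strict Implicit.
Unset Printing Implicit Defensive.
Import Order.TTheory GRing.Theory Num.Theory.
Import numFieldNormedType.Exports.
Local Open Scope classical_set_scope.
Local Open Scope ring_scope.

Definition affine_hull (R : realType) (E : normedModType R) (A : set E) :
    set E :=
  [set x | exists (n : nat) (v : 'I_n -> E) (w : 'I_n -> R),
    [/\ forall i, A (v i), \sum_(i < n) w i = 1 &
        x = \sum_(i < n) w i *: v i]].

(* The points of A of which A is a neighbourhood in the subspace topology of
   the affine hull of A. *)
Definition relative_interior (R : realType) (E : normedModType R)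
    (A : set E) : set E :=
  [set x | A x /\ within (affine_hull A) (nbhs x) A].

(* Cubic m x m x m matrices (p_{ij,k}), flattened so as to inherit the normed
   space structure of rectangular matrices: row k is the flattening (mxvec) of
   the square matrix (p_{ij,k})_{i,j}. The norm of 'M[R]_(_, _) is the maximum
   of the absolute values of the entries, hence induces the usual topology of
   R^(m^3). *)
Notation cubic_mx R m := 'M[R]_(m, (m * m)%N).

Section Qso.
Variables (R : realType) (m : nat).
Implicit Types (p : cubic_mx R m) (x y : 'rV[R]_m).

Definition coef p (i j k : 'I_m) : R := p k (mxvec_index i j).

Definition simplex : set 'rV[R]_m :=
  [set x | \sum_(i < m) x ord0 i = 1 /\ forall i, 0 <= x ord0 i].

Definition qso_coef : set (cubic_mx R m) :=
  [set p | [/\ forall i j k, coef p i j k = coef p j i k,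
               forall i j k, 0 <= coef p i j k &
               forall i j, \sum_(r < m) coef p i j r = 1]].

Definition qso p x : 'rV[R]_m :=
  \row_k \sum_(i < m) \sum_(j < m) coef p i j k * x ord0 i * x ord0 j.

(* x_[i+1] in the usual 1-based notation *)
Definition decr_coord x (i : nat) : R :=
  nth 0 (sort >=%R [seq x ord0 j | j <- enum 'I_m]) i.

Definition majorized x y : Prop :=
  forall k : nat, (1 <= k <= m.-1)%N ->
    \sum_(i < k) decr_coord x i <= \sum_(i < k) decr_coord y i.

Definition qbo : set (cubic_mx R m) :=
  [set p | qso_coef p /\ forall x, simplex x -> majorized (qso p x) x].

Definition regular p : Prop :=
  forall x, simplex x ->
    exists2 l, simplex l & iter n (qso p) x @[n --> \oo] --> l.

Definition strictly_regular p : Prop :=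
  regular p /\ exists! x, simplex x /\ qso p x = x.

End Qso.

Arguments simplex {R m}.
Arguments qso_coef {R m}.
Arguments qbo {R m}.

(* Main.v *)
Require Import Defs.
From mathcomp Require Import all_boot all_order all_algebra.
From mathcomp Require Import all_classical all_reals all_analysis.
From mathcomp Require Import ring lra.

Set Implicit Arguments.
Unset Strict Implicit.
Unset Printing Implicit Defensive.
Import Order.TTheory GRing.Theory Num.Theory.
Import numFieldNormedType.Exports.
Local Open Scope classical_set_scope.
Local Open Scope ring_scope.

(** Bistochastic operators do not increase the largest coordinate, and the
    constant operator whose value is the barycentre [c = (1/m, ..., 1/m)] is
    bistochastic: [c] is majorized by every point of the simplex
    ([barycentre_qso_qbo]). A point of the relative interior of a set can be
    pushed slightly away from any other point of that set without leaving it
    ([relative_interior_extend]); applied to the constant operator [C], this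
    gives [e > 0] such that [V' = V + e (V - C)] is again bistochastic. So
    [V = V' / (1 + e) + (e / (1 + e)) C] is a mixture of a bistochastic
    operator with the constant one.

    If all coordinates of [x] are at most [1/m + d], so are those of [V' x],
    and therefore those of [V x] are at most [1/m + d / (1 + e)]
    ([qso_contract]). Thus the excess of the largest coordinate over [1/m]
    decays geometrically along each trajectory. Since the coordinates sum to
    one, an upper bound close to [1/m] also forces them to be close to [1/m]
    from below ([simplex_dist_barycentre]), so every trajectory tends to [c],
    and no other point can be fixed. *)

(** * Relative interior *)

(** The line through [x] and [y] stays in the affine hull, and its points
    slightly beyond [x] lie in any given neighbourhood of [x]. *)
Lemma relative_interior_extend (R : realType) (E : normedModType R)
    (A : set E) (x y : E) :
  relative_interior A x -> A y ->
  exists2 e : R, 0 < e & A (x + e *: (x - y)).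
Proof.
move=> [Ax]; rewrite /within/= => Anear Ay.
have ray_cvg : x + e *: (x - y) @[e --> (0 : R)] --> x.
  rewrite -[X in _ --> X]addr0; apply: cvgD; first exact: cvg_cst.
  rewrite -[X in _ --> X](scale0r (x - y)); apply: cvgZr_tmp; exact: cvg_id.
have /nbhs_ballP[r /= r0 rA] := ray_cvg _ Anear.
exists (r / 2); first by rewrite divr_gt0.
apply: rA.
  by rewrite -ball_normE /= sub0r normrN gtr0_norm ?divr_gt0//
    ltr_pdivrMr// mulrDr mulr1 ltrDl.
exists 2, (fun i => if i == ord0 then x else y),
  (fun i => if i == ord0 then 1 + r / 2 else - (r / 2)).
split.
- by move=> i; case: ifP.
- by rewrite big_ord_recl big_ord1 /= addrK.
- by rewrite big_ord_recl big_ord1 /= scalerBr scalerDl scale1r scaleNr addrA.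
Qed.

Section Simplex.
Variables (R : realType) (m : nat).
Implicit Types (p : cubic_mx R m) (x y : 'rV[R]_m).

(** * Decreasing rearrangement *)

Lemma size_decr x : size (sort >=%R [seq x ord0 j | j <- enum 'I_m]) = m.
Proof. by rewrite size_sort size_map size_enum_ord. Qed.

Lemma decr_coord_homo x (i j : nat) :
  (i <= j)%N -> (j < m)%N -> decr_coord x j <= decr_coord x i.
Proof.
move=> ij jm; rewrite /decr_coord.
have ge_total : total (>=%R : rel R) by move=> a b; exact: ge_total.
have ge_trans : transitive (>=%R : rel R).
  by move=> b a c ba cb; exact: le_trans ba.
apply: (sorted_leq_nth ge_trans _ 0 (sort_sorted ge_total _)) => //.
- by move=> a; exact: lexx.
- by rewrite inE size_decr (leq_ltn_trans ij).
- by rewrite inE size_decr.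
Qed.

Lemma sum_decr_coord x :
  \sum_(0 <= i < m) decr_coord x i = \sum_(i < m) x ord0 i.
Proof.
rewrite -{1}(size_decr x) -(big_nth 0 xpredT id).
by rewrite (perm_big _ (permEl (perm_sort _ _))) /= big_map big_enum.
Qed.

Lemma coord_le_decr0 x (k : 'I_m) : x ord0 k <= decr_coord x 0.
Proof.
have : x ord0 k \in sort >=%R [seq x ord0 j | j <- enum 'I_m].
  by rewrite mem_sort; apply: map_f; rewrite mem_enum.
by move=> /(nthP 0)[i]; rewrite size_decr => im <-; exact: decr_coord_homo.
Qed.

Lemma decr_coord_mem x (i : nat) : (i < m)%N ->
  exists j, decr_coord x i = x ord0 j.
Proof.
move=> im; have : decr_coord x i \in [seq x ord0 j | j <- enum 'I_m].
  by rewrite -(mem_sort >=%R) mem_nth// size_decr.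
by move=> /mapP[j _ ->]; exists j.
Qed.

(** The [k] largest coordinates have at least the average [1/m] of all of
    them, because each of them is at least each of the [m - k] others. *)
Lemma top_sum_ge x (k : nat) : simplex x -> (k <= m)%N -> (0 < m)%N ->
  k%:R / m%:R <= \sum_(i < k) decr_coord x i.
Proof.
move=> [x1 _] km m0; rewrite -(big_mkord xpredT (decr_coord x)).
set top := \sum_(0 <= i < k) _.
set rest := \sum_(k <= i < m) decr_coord x i.
have split1 : top + rest = 1 by rewrite -x1 -sum_decr_coord -big_cat_nat.
have cross : k%:R * rest <= (m - k)%:R * top.
  have -> : k%:R * rest = \sum_(0 <= i < k) \sum_(k <= j < m) decr_coord x j.
    by rewrite big_const_nat subn0 iter_addr_0 mulr_natl.
  have -> : (m - k)%:R * top
      = \sum_(0 <= i < k) \sum_(k <= j < m) decr_coord x i.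
    rewrite mulr_sumr; apply: eq_bigr => i _.
    by rewrite big_const_nat iter_addr_0 mulr_natl.
  apply: ler_sum_nat => i /andP[_ ik]; apply: ler_sum_nat => j /andP[kj jm].
  exact/decr_coord_homo/jm/ltnW/(leq_trans ik).
rewrite ler_pdivrMr ?ltr0n// -(subrK k%:R m%:R) -natrB// mulrDr.
have split_k : k%:R * top + k%:R * rest = k%:R :> R.
  by rewrite -mulrDr split1 mulr1.
by rewrite -[leLHS]split_k addrC [top * k%:R]mulrC [top * _]mulrC lerD2r.
Qed.

(** * The barycentre and the constant operator *)

Definition barycentre : 'rV[R]_m := const_mx m%:R^-1.

Definition barycentre_qso : cubic_mx R m := const_mx m%:R^-1.

Hypothesis m_gt0 : (0 < m)%N.

Lemma simplex_barycentre : simplex barycentre.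
Proof.
split=> [|i]; last by rewrite mxE invr_ge0.
under eq_bigr do rewrite mxE.
by rewrite sumr_const card_ord -[LHS]mulr_natr mulVf// pnatr_eq0 -lt0n.
Qed.

(** An upper bound on all coordinates bounds each of them from below as well,
    since they sum to one. *)
Lemma simplex_dist_barycentre x (d : R) : simplex x ->
  (forall i, x ord0 i <= m%:R^-1 + d) ->
  forall k, `|x ord0 k - m%:R^-1| <= m%:R * d.
Proof.
move=> [x1 x0] xle k.
have [c1 _] := simplex_barycentre.
pose gap i := m%:R^-1 + d - x ord0 i.
have gap_ge0 i : 0 <= gap i by rewrite subr_ge0.
have gap_sum : \sum_i gap i = m%:R * d.
  rewrite big_split /= sumrN x1 big_split /=.
  have -> : \sum_(i < m) m%:R^-1 = 1 :> R.
    by rewrite -[RHS]c1; apply: eq_bigr => i _; rewrite mxE.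
  by rewrite sumr_const card_ord mulr_natl addrAC subrr add0r.
have gap_le : gap k <= m%:R * d.
  by rewrite -gap_sum (bigD1 k)//= lerDl sumr_ge0.
have d_ge0 : 0 <= d.
  have : 0 <= m%:R * d by rewrite -gap_sum sumr_ge0.
  by rewrite pmulr_rge0 // ltr0n.
have d_le : d <= m%:R * d by rewrite ler_peMl// ler1n.
move: gap_le (xle k); rewrite /gap => gap_le xk.
by rewrite ler_norml; apply/andP; split; lra.
Qed.

Lemma simplex_eq_barycentre x : simplex x ->
  (forall i, x ord0 i <= m%:R^-1) -> x = barycentre.
Proof.
move=> xS xle; apply/rowP => k; rewrite [RHS]mxE; apply/eqP.
have := @simplex_dist_barycentre x 0 xS _ k.
rewrite mulr0 normr_le0 subr_eq0; apply=> i.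
by rewrite addr0.
Qed.

(** * Quadratic stochastic operators *)

Lemma qso_simplex p x : qso_coef p -> simplex x -> simplex (qso p x).
Proof.
move=> [_ p0 p1] [x1 x0]; split=> [|k]; last first.
  rewrite mxE; apply: sumr_ge0 => i _; apply: sumr_ge0 => j _.
  by rewrite !mulr_ge0.
under eq_bigr do rewrite mxE.
rewrite exchange_big -[RHS]x1; apply: eq_bigr => i _ /=.
rewrite exchange_big /= -[RHS]mulr1 -x1 mulr_sumr; apply: eq_bigr => j _.
by rewrite -!mulr_suml p1 mul1r.
Qed.

Lemma iter_qso_simplex p x n : qso_coef p -> simplex x ->
  simplex (iter n (qso p) x).
Proof. by move=> pQ xS; elim: n => //= n; exact: qso_simplex. Qed.

Lemma qso_barycentre_qso x : simplex x -> qso barycentre_qso x = barycentre.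
Proof.
move=> [x1 _]; apply/rowP => k; rewrite !mxE.
under eq_bigr => i _.
  under eq_bigr do rewrite /coef mxE.
  rewrite -mulr_sumr x1 mulr1; over.
by rewrite -mulr_sumr x1 mulr1.
Qed.

Lemma barycentre_qso_qbo : qbo barycentre_qso.
Proof.
have [c1 c0] := simplex_barycentre.
split.
  split=> [i j k|i j k|i j]; rewrite /coef ?mxE ?invr_ge0//.
  by rewrite -[RHS]c1; apply: eq_bigr => k _; rewrite !mxE.
move=> x xS k /andP[_ km1]; rewrite qso_barycentre_qso//.
have km : (k <= m)%N := leq_trans km1 (leq_pred m).
apply: le_trans (top_sum_ge xS km m_gt0).
have -> : k%:R / m%:R = \sum_(i < k) m%:R^-1 :> R.
  by rewrite sumr_const card_ord mulr_natl.
apply: ler_sum => i _.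
by have [j ->] := decr_coord_mem barycentre (leq_trans (ltn_ord i) km);
  rewrite mxE.
Qed.

(** For [m >= 2] this is the majorization inequality for one coordinate; for
    [m = 1] majorization says nothing, but the simplex is a single point. *)
Lemma qbo_coord_le p x a : qbo p -> simplex x ->
  (forall i, x ord0 i <= a) -> forall k, qso p x ord0 k <= a.
Proof.
move=> [pQ pB] xS xle k.
have [m1|m_le1] := ltnP 1 m.
  apply: le_trans (coord_le_decr0 _ k) _.
  have := pB x xS 1%N; rewrite -subn1 subn_gt0 => /(_ m1).
  rewrite !big_ord1 => /le_trans; apply.
  by have [j ->] := decr_coord_mem x m_gt0.
have [x1 _] := xS; have [y1 y0] := qso_simplex pQ xS.
have only_k (i : 'I_m) : i = k.
  by apply: val_inj; case: i k => i im [j jm] /=;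
    case: m m_le1 im jm => [|[|]]// _; case: i => //; case: j.
have -> : qso p x ord0 k = x ord0 k.
  transitivity (1 : R); last rewrite -x1; [rewrite -[RHS]y1|];
    rewrite (bigD1 k)//= big1 ?addr0// => i; by rewrite (only_k i) eqxx.
exact: xle.
Qed.

Lemma qso_extrapolate p q (e : R) x :
  qso (p + e *: (p - q)) x = qso p x + e *: (qso p x - qso q x).
Proof.
apply/rowP => k; rewrite !mxE -sumrB mulr_sumr -big_split; apply: eq_bigr => i _.
rewrite -sumrB mulr_sumr -big_split; apply: eq_bigr => j _ /=.
by rewrite /coef !mxE; ring.
Qed.

(** The operator [V' = V + e (V - C)] keeps all coordinates below [1/m + d];
    solving for [V = (V' + e C) / (1 + e)] divides the excess [d] by
    [1 + e]. *)
Lemma qso_contract p (e : R) x d : 0 < e ->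
  qbo (p + e *: (p - barycentre_qso)) -> simplex x ->
  (forall i, x ord0 i <= m%:R^-1 + d) ->
  forall k, qso p x ord0 k <= m%:R^-1 + (1 + e)^-1 * d.
Proof.
move=> e0 pB xS xle k.
have := qbo_coord_le pB xS xle k.
rewrite qso_extrapolate qso_barycentre_qso// !mxE => le_k.
have e1 : 0 < 1 + e by rewrite addr_gt0.
rewrite -(ler_pM2l e1) mulrDr mulrA divff ?gt_eqF//.
lra.
Qed.

(** * Convergence *)

Lemma iter_qso_le p (e : R) x n : 0 < e -> qso_coef p ->
  qbo (p + e *: (p - barycentre_qso)) -> simplex x ->
  forall k, iter n (qso p) x ord0 k <= m%:R^-1 + (1 + e)^-1 ^+ n.
Proof.
move=> e0 pQ pB xS; elim: n => [|n IHn] k /=; last first.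
  by rewrite exprS; apply: qso_contract => //; exact: iter_qso_simplex.
have [x1 x0] := xS; apply: (@le_trans _ _ 1).
  by rewrite -x1 (bigD1 k)//= lerDl sumr_ge0.
by rewrite expr0 lerDr invr_ge0.
Qed.

Lemma iter_qso_cvg p (e : R) x : 0 < e -> qso_coef p ->
  qbo (p + e *: (p - barycentre_qso)) -> simplex x ->
  iter n (qso p) x @[n --> \oo] --> barycentre.
Proof.
move=> e0 pQ pB xS.
have bound_cvg : m%:R * (1 + e)^-1 ^+ n @[n --> \oo] --> (0 : R).
  rewrite -[X in _ --> X](mulr0 m%:R); apply: cvgMl_tmp; apply: cvg_expr.
  by rewrite ger0_norm ?invf_lt1 ?ltrDl ?invr_ge0 ?addr_ge0 ?addr_gt0// ltW.
apply/cvgrPdist_le => eps eps0.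
move/cvgrPdist_le : bound_cvg => /(_ _ eps0); apply: filterS => n.
rewrite sub0r normrN => bound_n.
rewrite [leLHS]mx_normrE; apply: bigmax_le; first exact: ltW.
move=> [i k] _ /=; rewrite ord1 mxE [X in X + _]mxE [X in _ + X]mxE distrC.
apply: le_trans (le_trans (ler_norm _) bound_n).
apply: simplex_dist_barycentre; first exact: iter_qso_simplex.
exact: iter_qso_le.
Qed.

End Simplex.

Theorem theorem3p3 (R : realType) (m : nat) (m_gt0 : (0 < m)%N)
    (V : cubic_mx R m) (V_ri : relative_interior qbo V) :
  strictly_regular V.
Proof.
have [V_qbo _] := V_ri; have [V_qso _] := V_qbo.
have [e e0 ext_qbo] :=
  relative_interior_extend V_ri (barycentre_qso_qbo R m_gt0).
have cS := simplex_barycentre R m_gt0.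
have to_c x : simplex x -> iter n (qso V) x @[n --> \oo] --> barycentre R m.
  by move=> xS; exact: (iter_qso_cvg m_gt0 e0).
split=> [x xS|]; first by exists (barycentre R m) => //; exact: to_c.
exists (barycentre R m); split=> [|x [xS Vx]].
  split=> //; apply: simplex_eq_barycentre => //; first exact: qso_simplex.
  by move=> i; apply: qbo_coord_le => // j; rewrite mxE.
have const_iter n : iter n (qso V) x = x by elim: n => //= n ->.
have x_cvg : iter n (qso V) x @[n --> \oo] --> x.
  by under eq_fun do rewrite const_iter; exact: cvg_cst.
exact: (cvg_unique (@norm_hausdorff _ _) (to_c x xS) x_cvg).
Qed.
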